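(* Let $C$ and $S$ be random variables representing the community label and the sensitive attribute, respectively, and let $\hat{Y}$ be a random variable denoting the output of a downstream prediction task. Assume that $C$ is highly correlated with $\hat{Y}$, i.e., $\rho_{C,\hat{Y}}$ is larger than a positive constant $\cos\alpha$, where $\alpha \in [0,\pi/2)$. If the model is trained to make $\rho_{S,C}$ close to zero, i.e., $$\rho_{S,C} \in \left[\cos\left(\tfrac{\pi}{2}+\delta\right), \cos\left(\tfrac{\pi}{2}-\delta\right)\right],$$ where $\delta$ is close to $0$, then the correlation between the sensitive attribute $S$ and the downstream prediction $\hat{Y}$ satisfies $$\rho_{S,\hat{Y}} \in \left[\cos\left(\tfrac{\pi}{2}+\delta+\alpha\right), \cos\left(\tfrac{\pi}{2}-\delta-\alpha\right)\right].$$
   Context: For real-valued random variables $X, Y$ with means $\mu_X,\mu_Y$ and (finite, nonzero) standard deviations $\sigma_X,\sigma_Y$, the Pearson correlation coefficient is $\rho_{X,Y} = \dfrac{\mathbb{E}[(X-\mu_X)(Y-\mu_Y)]}{\sigma_X\sigma_Y}$. The variables $C$, $S$, $\hat{Y}$ are real-valued and such that these coefficients are defined. The setting is a graph of users: each user (node) has a binary sensitive attribute $S \in \{0,1\}$, a community label $C$ produced by a community detection procedure on the graph, and a prediction $\hat{Y}$ from a model trained on the graph for a downstream task; ''the model is trained to make $\rho_{S,C}$ close to zero'' refers to reducing the dependence of the community labels on the sensitive attribute (by adding links to the graph). The condition ''$\delta$ is close to $0$'' is not quantified further.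
   Formalization: ''δ is close to 0'' is made precise as |δ| ≤ π/2 − α; without such a bound depending on α the claim fails, e.g. δ = 0.1, α = 1.5, S = Ŷ, ρ_{C,Ŷ} = cos 1.48, where ρ_{S,Ŷ} = 1 > cos(π/2 − δ − α). *)

(* Defs.v *)
From HB Require Import structures.
From mathcomp Require Import all_boot all_order all_algebra.
From mathcomp Require Import all_classical all_reals all_analysis.
Set Implicit Arguments.
Unset Strict Implicit.
Unset Printing Implicit Defensive.
Import Order.TTheory GRing.Theory Num.Theory.
Local Open Scope ring_scope.

Definition std_dev (d : measure_display) (T : measurableType d) (R : realType)
    (P : probability T R) (X : T -> R) : R :=
  Num.sqrt (fine 'V_P[X]).

(* The mean and the standard deviation of X are finite, and the latter is
   nonzero.  When this holds for both X and Y, the covariance of X and Y is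
   finite, so that [fine] loses nothing in [pearson]. *)
Definition finite_mean_pos_std_dev (d : measure_display) (T : measurableType d)
    (R : realType) (P : probability T R) (X : T -> R) : Prop :=
  X \in Lfun P 1 /\ (0 < 'V_P[X] < +oo)%E.

Definition pearson (d : measure_display) (T : measurableType d) (R : realType)
    (P : probability T R) (X Y : T -> R) : R :=
  fine (covariance P X Y) / (std_dev P X * std_dev P Y).

(* Main.v *)
(* Cauchy-Schwarz applied to the residuals of S and Yhat after regression on C
   says that (y - r c)^2 <= (1 - r^2)(1 - c^2) for the three correlations
   r = rho(S,C), c = rho(C,Yhat), y = rho(S,Yhat). With r = sin t and c = cos u
   this reads |y - r c| <= cos t sin u, so y <= sin (t + u), where t <= delta
   and u <= alpha, and sin is increasing on [-pi/2, pi/2]. The lower bound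
   follows on replacing S by -S. *)
Require Import Defs.
From HB Require Import structures.
From mathcomp Require Import all_boot all_order all_algebra.
From mathcomp Require Import ring lra.
From mathcomp Require Import all_classical all_reals all_analysis.
From mathcomp Require Import measurable_realfun.
Set Implicit Arguments.
Unset Strict Implicit.
Unset Printing Implicit Defensive.
Import Order.TTheory GRing.Theory Num.Theory.
Local Open Scope ring_scope.

Section pearson.
Context (R : realType) (d : measure_display) (T : measurableType d)
  (P : probability T R).

Lemma Lfun2_finite_integral_sqr (f : T -> R) : measurable_fun [set: T] f ->
  (\int[P]_x (f x ^+ 2)%:E < +oo)%E -> f \in Lfun P 2%:E.
Proof.
move=> mf f2; rewrite inE; apply/andP; split; rewrite inE//=.
rewrite /finite_norm unlock /= poweR_lty//.
by under eq_integral => x _ do rewrite powR_mulrn// real_normK ?num_real//.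
Qed.

(** The variance is the integral of the square of [X \- cst (fine 'E_P[X])], so this difference is
    in L^2, and so is the constant added back, [P] being finite. *)
Lemma finite_variance_Lfun2 (X : {RV P >-> R}) :
  ('V_P[X] < +oo)%E -> (X : T -> R) \in Lfun P 2%:E.
Proof.
move=> VX; have X2 : (X \- cst (fine 'E_P[X]) : T -> R) \in Lfun P 2%:E.
  apply: Lfun2_finite_integral_sqr; first exact: measurable_funB.
  by move: VX; rewrite /variance !unlock.
have -> : (X : T -> R) = (X \- cst (fine 'E_P[X])) \+ cst (fine 'E_P[X]).
  by apply/funext => x /=; rewrite subrK.
rewrite rpredD ?lee1n//= => _; exact: Lfun_cst.
Qed.

Let cov X Y : R := fine (covariance P X Y).

Lemma Lfun2_scale a (X : T -> R) : X \in Lfun P 2%:E -> a \o* X \in Lfun P 2%:E.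
Proof. by move=> X2; rewrite Lfun_scale// ler1n. Qed.

(** Bilinearity; square integrability makes each covariance finite, so [fine] commutes with the
    operations. It serves both the quadratic polynomial behind Cauchy-Schwarz and the regression
    residuals. *)
Lemma fine_covariance_sub_scale a b (X Y Z : T -> R) :
    X \in Lfun P 2%:E -> Y \in Lfun P 2%:E -> Z \in Lfun P 2%:E ->
  cov (X \- a \o* Z) (Y \- b \o* Z) =
    cov X Y - b * cov X Z - a * cov Y Z + a * b * cov Z Z.
Proof.
move=> X2 Y2 Z2; have Pfin := fin_num_measure P _ (@measurableT _ T).
have fin U V : U \in Lfun P 2%:E -> V \in Lfun P 2%:E ->
    covariance P U V \is a fin_num.
  by move=> U2 V2; rewrite covariance_fin_num ?Lfun2_mul_Lfun1 ?Lfun_subset12.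
rewrite /cov; have aZ := Lfun2_scale a Z2; have bZ := Lfun2_scale b Z2.
have ZrE c U V : U \in Lfun P 2%:E -> V \in Lfun P 2%:E ->
    fine (covariance P U (c \o* V)) = c * fine (covariance P U V).
  move=> U2 V2.
  by rewrite covarianceZr ?Lfun2_mul_Lfun1 ?Lfun_subset12// fineM ?fin.
have ZlE c U V : U \in Lfun P 2%:E -> V \in Lfun P 2%:E ->
    fine (covariance P (c \o* U) V) = c * fine (covariance P U V).
  by move=> U2 V2; rewrite covarianceC ZrE// covarianceC.
rewrite covarianceBl ?rpredB ?lee1n// !covarianceBr//.
rewrite !fineB ?fin_numB ?fin//.
rewrite !ZlE// !ZrE// (covarianceC _ Z Y).
ring.
Qed.

Lemma fine_covariance_le (X Y : T -> R) :
    X \in Lfun P 2%:E -> Y \in Lfun P 2%:E ->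
  cov X Y ^+ 2 <= cov X X * cov Y Y.
Proof.
move=> X2 Y2.
have quad a : 0 <= cov X X - a * cov X Y *+ 2 + a ^+ 2 * cov Y Y.
  have := fine_ge0 (variance_ge0 P (X \- a \o* Y)).
  rewrite [fine _](fine_covariance_sub_scale a a X2 X2 Y2).
  by congr (_ <= _); ring.
move: quad (fine_ge0 (variance_ge0 P Y)); rewrite -/(cov Y Y).
move: (cov X X) (cov X Y) (cov Y Y) => p b q quad.
rewrite le_eqVlt => /predU1P[q0|q0].
  (* For [q = 0] the polynomial [quad] is affine in [a]; if its slope were nonzero, the value of [a]
     chosen below would make it equal to -1. *)
  have [->|b0] := eqVneq b 0; first by rewrite expr0n -q0 mulr0.
  have := quad ((p + 1) / (b *+ 2)).
  have -> : (p + 1) / (b *+ 2) * b *+ 2 = p + 1 by field.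
  rewrite -q0; lra.
(* For [q > 0] the polynomial is minimal at [b / q]. *)
have := quad (b / q).
rewrite -(pmulr_lge0 _ q0).
have -> : (p - b / q * b *+ 2 + (b / q) ^+ 2 * q) * q = p * q - b ^+ 2.
  by field; rewrite gt_eqF.
by rewrite subr_ge0.
Qed.


Lemma std_dev_gt0 (X : T -> R) :
  finite_mean_pos_std_dev P X -> 0 < std_dev P X.
Proof. by case=> _ VX; rewrite sqrtr_gt0 fine_gt0. Qed.

Lemma sqr_std_dev (X : T -> R) : std_dev P X ^+ 2 = cov X X.
Proof. by rewrite sqr_sqrtr// fine_ge0// variance_ge0. Qed.

Lemma pearsonC (X Y : T -> R) : pearson P X Y = pearson P Y X.
Proof. by rewrite /pearson covarianceC mulrC [std_dev _ _ * _]mulrC mulrC. Qed.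

Lemma pearson_sqr_le1 (X Y : {RV P >-> R}) :
    finite_mean_pos_std_dev P X -> finite_mean_pos_std_dev P Y ->
  pearson P X Y ^+ 2 <= 1.
Proof.
move=> hX hY; have sX := std_dev_gt0 hX; have sY := std_dev_gt0 hY.
case: hX hY => _ /andP[_ /finite_variance_Lfun2 X2].
case=> _ /andP[_ /finite_variance_Lfun2 Y2].
rewrite expr_div_n ler_pdivrMr ?exprn_gt0 ?mulr_gt0// mul1r exprMn !sqr_std_dev.
exact: fine_covariance_le.
Qed.

(** Moving everything to the right-hand side gives the determinant of the 3 by 3 correlation matrix,
    a Gram determinant. *)
Lemma sqr_partial_pearson_le (X Y Z : {RV P >-> R}) :
    finite_mean_pos_std_dev P X -> finite_mean_pos_std_dev P Y ->
    finite_mean_pos_std_dev P Z ->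
  (pearson P X Y - pearson P X Z * pearson P Z Y) ^+ 2 <=
    (1 - pearson P X Z ^+ 2) * (1 - pearson P Z Y ^+ 2).
Proof.
move=> hX hY hZ; rewrite (pearsonC Z).
have sX := std_dev_gt0 hX; have sY := std_dev_gt0 hY; have sZ := std_dev_gt0 hZ.
case: hX hY hZ => _ /andP[_ /finite_variance_Lfun2 X2].
case=> _ /andP[_ /finite_variance_Lfun2 Y2].
case=> _ /andP[_ /finite_variance_Lfun2 Z2].
(* The residuals of [X] and [Y] after linear regression on [Z]. *)
pose a := cov X Z / cov Z Z; pose b := cov Y Z / cov Z Z.
have sub2 c U : U \in Lfun P 2%:E -> U \- c \o* Z \in Lfun P 2%:E.
  by move=> U2; rewrite rpredB ?lee1n//= Lfun2_scale.
have := fine_covariance_le (sub2 a _ X2) (sub2 b _ Y2).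
rewrite !fine_covariance_sub_scale// {}/a {}/b -!sqr_std_dev.
rewrite /pearson -!/(cov _ _).
move: sX sY sZ; move: (std_dev P X) (std_dev P Y) (std_dev P Z) => x y z.
move: (cov X Y) (cov X Z) (cov Y Z) => p q r x0 y0 z0 h.
(* Multiplying by [(x * y) ^+ 2] turns the correlations back into the covariances of the residuals
   in [h]. *)
have xy0 : 0 < (x * y) ^+ 2 by rewrite exprn_gt0// mulr_gt0.
rewrite -(ler_pM2r xy0); move: h; congr (_ <= _).
  by field; rewrite ?gt_eqF.
by field; rewrite ?gt_eqF.
Qed.

End pearson.

Section trig.
Context (R : realType).

Lemma ler_sin :
  {in `[- (pi / 2), pi / 2] &, {mono (@sin R) : x y / x <= y}}.
Proof. by move=> x y xI yI; rewrite leNgt ltr_sin// -leNgt. Qed.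

Lemma ler_cos : {in `[0, pi] &, {mono (@cos R) : x y /~ y <= x}}.
Proof. by move=> x y xI yI; rewrite leNgt ltr_cos// -leNgt. Qed.

(** An upper bound suffices: the hypotheses are invariant under negating both [r] and [y], which
    yields the lower bound. *)
Lemma le_sin_of_gram_det_ge0 (r c y a e : R) :
    `|e| <= pi / 2 - a -> `|r| <= sin e -> cos a <= c <= 1 -> 0 <= a ->
    (y - r * c) ^+ 2 <= (1 - r ^+ 2) * (1 - c ^+ 2) ->
  y <= sin (e + a).
Proof.
move=> ea re /andP[ac c1] a0 yrc.
have sine1 : sin e <= 1 by exact: sin_le1.
have [r0 r1] : - sin e <= r /\ r <= sin e by apply/andP; rewrite -ler_norml.
have pi0 : 0 < pi / 2 :> R by rewrite divr_gt0// pi_gt0.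
have [e0 e1] : - (pi / 2 - a) <= e /\ e <= pi / 2 - a
  by apply/andP; rewrite -ler_norml.
have cosa0 : 0 <= cos a by apply: cos_ge0_pihalf; apply/andP; split; lra.
have r11 : -1 <= r <= 1 by apply/andP; split; lra.
have c11 : -1 <= c <= 1 by apply/andP; split; lra.
have sin_asin : sin (asin r) = r by rewrite asinK// in_itv.
have cos_acos : cos (acos c) = c by rewrite acosK// in_itv.
(* The square root of the right-hand side of [yrc] is [cos (asin r) * sin (acos c)], the other term
   of the addition formula. *)
have ry : y <= sin (asin r + acos c).
  rewrite sinD sin_asin cos_acos cos_asin// sin_acos// -sqrtrM; last by nra.
  by rewrite addrC -lerBlDr (le_trans (ler_norm _))// -sqrtr_sqr ler_wsqrtr.
have [asinNp asinp] := (asin_geNpi2 r11, asin_lepi2 r11).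
have [acos0 acosp] := (acos_ge0 c11, acos_lepi c11).
have asin_le : asin r <= e.
  by rewrite -ler_sin ?sin_asin// in_itv/=; apply/andP; split; lra.
have asin_ge : - e <= asin r.
  by rewrite -ler_sin ?sin_asin ?sinN// in_itv/=; apply/andP; split; lra.
have acos_le : acos c <= a.
  by rewrite -ler_cos ?cos_acos// in_itv/=; apply/andP; split; lra.
(* Both angles lie in [[- (pi / 2), pi / 2]]: the bound on [e] gives [e + a <= pi / 2], and
   [asin r + acos c] is at least [- (pi / 2)]. *)
by rewrite (le_trans ry)// ler_sin ?in_itv/=; lra.
Qed.

End trig.

Theorem theorem1 (R : realType) (d : measure_display) (T : measurableType d)
    (P : probability T R) (C S Yhat : {RV P >-> R}) (alpha delta : R)
    (hC : finite_mean_pos_std_dev P C)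
    (hS : finite_mean_pos_std_dev P S)
    (hY : finite_mean_pos_std_dev P Yhat)
    (halpha : 0 <= alpha < pi / 2)
    (hCY : cos alpha < pearson P C Yhat)
    (hdelta : `|delta| <= pi / 2 - alpha)
    (hSC : cos (pi / 2 + delta) <= pearson P S C <= cos (pi / 2 - delta)) :
  cos (pi / 2 + delta + alpha) <= pearson P S Yhat
    <= cos (pi / 2 - delta - alpha).
Proof.
have cos_Dpihalf x : cos (pi / 2 + x) = - sin x by rewrite addrC cosDpihalf.
(* Both intervals are symmetric about 0, so hypothesis and goal become bounds on absolute values by
   [sin delta] and [sin (delta + alpha)]. *)
move: hSC; rewrite -!addrA -opprD !cos_Dpihalf !sinN !opprK -!ler_norml => hSC.
case/andP: halpha => alpha0 _.
have /andP[_ c1] : -1 <= pearson P C Yhat <= 1.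
  rewrite -ler_norml -(@ler_sqr _ _ 1) ?nnegrE// expr1n.
  by rewrite real_normK ?num_real// pearson_sqr_le1.
have hc : cos alpha <= pearson P C Yhat <= 1 by rewrite ltW.
have partial := sqr_partial_pearson_le hS hY hC.
rewrite ler_norml lerNl; apply/andP; split.
  (* The passage from [S] to its negative is made on the correlations themselves, not on the random
     variable. *)
  apply: (@le_sin_of_gram_det_ge0 _ (- pearson P S C) (pearson P C Yhat)) => //.
    by rewrite normrN.
  by rewrite sqrrN mulNr -opprD sqrrN.
exact: (@le_sin_of_gram_det_ge0 _ (pearson P S C) (pearson P C Yhat)).
Qed.
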